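(* Let $n\ge1$ be an integer and $b=4n$. Then there is no infinite smooth word over $\{1,b\}$ that is an infinite Lyndon word.
   Context: Words are compared lexicographically with $1<b$. For a word $w$ over $\{1,b\}$ written as maximal blocks $\alpha_0^{i_0}\alpha_1^{i_1}\cdots$ ($\alpha_{k+1}\ne\alpha_k$, $i_k\ge1$), $\Delta(w)=i_0i_1\cdots$. An infinite word $w\in\{1,b\}^\omega$ is smooth if $\Delta^k(w)\in\{1,b\}^\omega$ for all $k\ge0$. An infinite Lyndon word is an infinite word strictly smaller than each of its proper suffixes. *)

(* Defs.v *)
From mathcomp Require Import all_boot.

Set Implicit Arguments.
Unset Strict Implicit.
Unset Printing Implicit Defensive.

(* Letters are natural numbers, so that w and Delta(w) live in the same type;
   the order 1 < b on letters is the order of nat. *)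
Definition infinite_word := nat -> nat.

Definition over (b : nat) (w : infinite_word) : Prop :=
  forall i, w i = 1 \/ w i = b.

(* Start position of the k-th block when the blocks have lengths v 0, v 1, ... *)
Definition block_start (v : infinite_word) (k : nat) : nat := \sum_(j < k) v j.

(* Delta w v: w is the concatenation over k of the maximal blocks
   (alpha k)^(v k), i.e. Delta(w) = v. There is no such v when w is eventually
   constant: its last block is then infinite, so Delta(w) is not an infinite
   word. *)
Definition Delta (w v : infinite_word) : Prop :=
  exists alpha : infinite_word, forall k,
    [/\ alpha k.+1 <> alpha k, 1 <= v k &
        forall i, i < v k -> w (block_start v k + i) = alpha k].

Fixpoint Delta_iter (k : nat) (w v : infinite_word) : Prop :=
  if k is k'.+1 then exists2 u, Delta_iter k' w u & Delta u v else w =1 v.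

Definition smooth (b : nat) (w : infinite_word) : Prop :=
  forall k, exists2 v, Delta_iter k w v & over b v.

Definition lex_lt (u v : infinite_word) : Prop :=
  exists2 k, forall i, i < k -> u i = v i & u k < v k.

Definition suffix_from (m : nat) (w : infinite_word) : infinite_word :=
  fun i => w (m + i).

Definition infinite_Lyndon (w : infinite_word) : Prop :=
  forall m, 1 <= m -> lex_lt w (suffix_from m w).

(* Main.v *)
(** Code a word over {1, b} by booleans, [true] standing for b.  If
    x = Delta^k(w) for a Lyndon smooth word w, the comparison of w with its
    suffixes becomes a comparison of x with some of its own suffixes, in an
    order where at each position a finite amount of parity information on the
    prefix tells whether 1 or b is the smaller letter.  These parities are the
    states of an automaton reading x, and the automaton for Delta(x) arises by
    letting each letter act as the corresponding block of x; as the letter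
    actions have order dividing 8, a block of length b = 4n acts through the
    parity of n only.  The Lyndon property makes some (state, letter) pairs
    impossible ("bad"), and badness too is inherited by Delta(x).  The word is
    determined by the first letters of the words Delta^k(w); splitting on
    them, every choice runs into a bad pair within the first few letters of
    some Delta^k(w), which is a finite computation. *)

From mathcomp Require Import all_boot zify.
Require Import Defs.

Set Implicit Arguments.
Unset Strict Implicit.
Unset Printing Implicit Defensive.

(** * Derivatives of smooth words *)

Lemma block_startS (v : infinite_word) k :
  block_start v k.+1 = block_start v k + v k.
Proof. by rewrite /block_start big_ord_recr. Qed.

Lemma block_start_ext (v v' : infinite_word) k :
  (forall j, j < k -> v j = v' j) -> block_start v k = block_start v' k.
Proof. by move=> e; apply: eq_bigr => j _; apply: e. Qed.

(** Were [v k < v' k], position [block_start v k.+1] would open a new block for [v] yet still lie in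
    block [k] for [v'], so two consecutive blocks of [v] would share a letter. *)
Lemma Delta_le (w v v' : infinite_word) k :
  Delta w v -> Delta w v' -> (forall j, j < k -> v j = v' j) -> v' k <= v k.
Proof.
move=> [al H] [al' H'] e; rewrite leqNgt; apply/negP => lt_k.
have eqB := block_start_ext e.
have [neq vk0 Hk] := H k; have [_ vk1 Hk1] := H k.+1; have [_ _ Hk'] := H' k.
apply: neq.
rewrite -(Hk1 0 vk1) -(Hk 0 vk0) block_startS !addn0 eqB (Hk' _ lt_k).
by rewrite -[block_start v' k]addn0 (Hk' 0 (leq_trans vk0 (ltnW lt_k))).
Qed.

Lemma Delta_unique (w v v' : infinite_word) :
  Delta w v -> Delta w v' -> v =1 v'.
Proof.
move=> Hv Hv'; elim/ltn_ind => k IH.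
apply/eqP; rewrite eqn_leq (Delta_le Hv' Hv) ?(Delta_le Hv Hv') //.
by move=> j /IH ->.
Qed.

Lemma Delta_ext (w w' v : infinite_word) : w =1 w' -> Delta w v -> Delta w' v.
Proof.
move=> e [al H]; exists al => k; have [h1 h2 h3] := H k.
by split=> // i hi; rewrite -e h3.
Qed.

Lemma Delta_iter_ext k (w w' v : infinite_word) :
  w =1 w' -> Delta_iter k w v -> Delta_iter k w' v.
Proof.
elim: k v => [|k IH] v e /=; first by move=> e' i; rewrite -e.
by case=> u /(IH _ e) Hu Hv; exists u.
Qed.

Lemma Delta_iterSr k (w v : infinite_word) :
  Delta_iter k.+1 w v -> exists2 u, Delta w u & Delta_iter k u v.
Proof.
elim: k v => [|k IH] v.
  case=> u /= e Hv; exists v => //; apply: (Delta_ext _ Hv) => i.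
  by rewrite e.
by case=> u /IH [u' h1 h2] h3; exists u' => //; exists u.
Qed.

Lemma smooth_over b w : smooth b w -> over b w.
Proof. by move=> sw i; have [v /= e /(_ i)] := sw 0; rewrite e. Qed.

Lemma smooth_Delta b w : smooth b w -> exists2 v, Delta w v & smooth b v.
Proof.
move=> sw; have [_ /Delta_iterSr [v dv _] _] := sw 1; exists v => // k.
have [v' /Delta_iterSr [u du iu] ov'] := sw k.+1; exists v' => //.
by apply: Delta_iter_ext iu; apply: Delta_unique du dv.
Qed.

(** * Boolean words *)

Definition bword := nat -> bool.

Definition len b (l : bool) := if l then b else 1.

Definition bstart b (y : bword) k := \sum_(j < k) len b (y j).

Definition decodes b (x y : bword) :=
  forall k i, i < len b (y k) -> x (bstart b y k + i) = x 0 (+) odd k.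

Fixpoint derivable_times b d (x : bword) : Prop :=
  if d is d'.+1 then exists2 y, decodes b x y & derivable_times b d' y
  else True.

Definition bcode b (w : infinite_word) : bword := fun i => w i == b.

Lemma Delta_decodes b w v :
  1 < b -> over b w -> over b v -> Delta w v ->
  decodes b (bcode b w) (bcode b v).
Proof.
move=> b1 ow ov [al H].
have lenE k : len b (bcode b v k) = v k.
  by rewrite /bcode; case: (ov k) => ->; rewrite ?eqxx //= ltn_eqF.
have startE k : bstart b (bcode b v) k = block_start v k.
  by apply: eq_bigr => j _; rewrite lenE.
have first k : w (block_start v k) = al k.
  by have [_ h1 h2] := H k; rewrite -[block_start v k]addn0 h2.
have altE k : (al k == b) = (w 0 == b) (+) odd k.
  elim: k => [|k IH]; first by rewrite -first /block_start big_ord0 addbF.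
  have [neq _ _] := H k; rewrite /= addbN -IH; move: neq.
  rewrite -!first; case: (ow (block_start v k)) => ->;
    case: (ow (block_start v k.+1)) => ->; by rewrite ?eqxx // ltn_eqF.
move=> k i; rewrite lenE startE => hi; have [_ _ h] := H k.
by rewrite /bcode h // altE.
Qed.

Lemma smooth_derivable b w d :
  1 < b -> smooth b w -> derivable_times b d (bcode b w).
Proof.
move=> b1; elim: d w => [//|d IH] w sw.
have [v dv sv] := smooth_Delta sw; exists (bcode b v); last exact: IH.
by apply: Delta_decodes => //; apply: smooth_over.
Qed.

Lemma bstartS b y k : bstart b y k.+1 = bstart b y k + len b (y k).
Proof. by rewrite /bstart big_ord_recr. Qed.

Lemma bstart0 b y : bstart b y 0 = 0.
Proof. by rewrite /bstart big_ord0. Qed.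

Section Blocks.

Variable b : nat.
Hypothesis b4 : 4 <= b.

Lemma len_gt0 l : 0 < len b l.
Proof. by case: l => //=; apply: leq_trans b4. Qed.

Lemma leq_bstart y k : k <= bstart b y k.
Proof.
elim: k => // k IH; rewrite bstartS -addn1.
by apply: leq_add => //; apply: len_gt0.
Qed.

Section Decode.

Variables x y : bword.
Hypothesis dxy : decodes b x y.

Lemma decodes_start k : x (bstart b y k) = x 0 (+) odd k.
Proof. by rewrite -[bstart b y k]addn0 dxy ?len_gt0. Qed.

Lemma decodes_next k :
  x (bstart b y k).+1 = x (bstart b y k) (+) ~~ y k.
Proof.
case yk: (y k) => /=.
  rewrite decodes_start addbF -addn1 dxy // yk /=; lia.
have := decodes_start k.+1; rewrite bstartS yk /= addn1 => ->.
by rewrite decodes_start addbN addbT.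
Qed.

Lemma decodes1 : x 1 = x 0 (+) ~~ y 0.
Proof. by have := decodes_next 0; rewrite bstart0. Qed.

(** Equal parities give blocks [k + i] and [k' + i] the same letter, so equal lengths make these
    stretches of [x] coincide; [L] is their common length. *)
Lemma agree_blocks k k' l :
  odd k = odd k' -> (forall i, i < l -> y (k + i) = y (k' + i)) ->
  exists L, [/\ bstart b y (k + l) = bstart b y k + L,
    bstart b y (k' + l) = bstart b y k' + L, l <= L &
    forall i, i < L -> x (bstart b y k + i) = x (bstart b y k' + i)].
Proof.
move=> kk'; elim: l => [|l IH] agr; first by exists 0; rewrite !addn0.
have [L [e1 e2 lL agrL]] := IH (fun i hi => agr i (ltnW hi)).
have eyl := agr l (ltnSn l).
exists (L + len b (y (k + l))); split.
- by rewrite addnS bstartS e1 addnA.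
- by rewrite addnS bstartS e2 eyl addnA.
- by have := len_gt0 (y (k + l)); lia.
move=> i hi; case: (ltnP i L) => [/agrL //|Li].
rewrite -(subnKC Li) !addnA -e1 -e2 !dxy ?oddD ?kk' -?eyl //; lia.
Qed.

End Decode.

End Blocks.

(** * Automata *)

(* [small1 s] says that 1 is the smaller letter when [s] is the current state. *)
Record automaton := Automaton {
  state : eqType;
  step : state -> bool -> state;
  init : state;
  small1 : state -> bool;
  bad : state -> bool -> bool;
  states : seq state }.

(* [e] is a substitute for b, equal to it modulo 8.  The first component of a
   lifted state is the letter of x of which the next letter of Delta(x) counts
   the repetitions; at the first mismatch of Delta(x) the shorter block is
   followed by the other letter, whence [small1]. *)
Definition lift (e : nat) (c : bool) (A : automaton) : automaton :=
  Automaton (state := (bool * state A)%type)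
    (fun s l => (~~ s.1, iter (len e l) ((@step A)^~ s.1) s.2))
    (c, init A)
    (fun s => s.1 == small1 (step s.2 s.1))
    (fun s l => has (fun d => bad (iter d ((@step A)^~ s.1) s.2) s.1)
                    (iota 0 (len 4 l)))
    [seq (c, s) | c <- [:: true; false], s <- states A].

Definition add_bad (A : automaton) (B : state A -> bool -> bool) : automaton :=
  Automaton (@step A) (init A) (@small1 A) (fun s l => bad s l || B s l)
    (states A).

(** This lets a block of length b be read as one of length [e], and it makes each letter act
    injectively. *)
Definition period8 (A : automaton) : bool :=
  all (fun s => all (fun l => iter 8 ((@step A)^~ l) s == s) [:: true; false])
      (states A).

Definition complete (A : automaton) := forall s : state A, s \in states A.

(** Every word of length [m] read from [s] meets a bad pair. *)
Fixpoint dead (A : automaton) (m : nat) (s : state A) : bool :=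
  if m is m'.+1 then
    all (fun l => if bad s l then true else dead m' (step s l)) [:: true; false]
  else false.

(* The conditionals, unlike [||], are evaluated lazily by [vm_compute]. *)
Fixpoint refuted (e m d : nat) (A : automaton) : bool :=
  if dead m (init A) then true
  else if d is d'.+1 then
    period8 A && all (fun c => refuted e m d' (lift e c A)) [:: true; false]
  else false.

Fixpoint run (A : automaton) (x : bword) (k : nat) : state A :=
  if k is k'.+1 then step (run A x k') (x k') else init A.

Definition safe (A : automaton) (x : bword) :=
  forall k, ~~ bad (run A x k) (x k).

(** Only suffixes starting where the automaton is back in its initial state are compared. With
    [0 < l] the suffix shares the first letter of [x], on which [minimal_lift_from1] relies. *)
Definition minimal (A : automaton) (x : bword) :=
  forall k l, 0 < k -> 0 < l -> run A x k = init A ->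
    (forall i, i < l -> x (k + i) = x i) -> x (k + l) <> x l ->
    ~~ x l = small1 (run A x l).

(** Here the suffixes are compared with [x] deprived of its first letter; [l = 0] is allowed, and
    [no_cut1] uses it. *)
Definition minimal_from1 (A : automaton) (x : bword) :=
  forall k l, 1 < k -> run A x k = run A x 1 ->
    (forall i, i < l -> x (k + i) = x i.+1) -> x (k + l) <> x l.+1 ->
    ~~ x l.+1 = small1 (run A x l.+1).

Lemma complete_lift e c A : complete A -> complete (lift e c A).
Proof.
move=> cA [c' s]; apply/allpairsP; exists (c', s).
by split=> //=; case: c'.
Qed.

Lemma period8_iter A s l :
  complete A -> period8 A -> iter 8 ((@step A)^~ l) s = s.
Proof.
by move=> cA /allP/(_ s (cA s))/allP/(_ l) h; apply/eqP/h; case: l {h}.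
Qed.

Lemma step_inj A l s s' :
  complete A -> period8 A -> step s l = step s' l -> s = s' :> state A.
Proof.
move=> cA pA e; rewrite -(period8_iter s l cA pA) -(period8_iter s' l cA pA).
by rewrite !(iterSr 7) e.
Qed.

Lemma dead_not_safe A x m k : safe A x -> dead m (run A x k) -> False.
Proof.
move=> sx; elim: m k => [//|m IH] k /allP/(_ (x k)) h.
have /h : x k \in [:: true; false] by case: (x k).
by rewrite (negPf (sx k)) => /(IH k.+1).
Qed.

Lemma complete_add_bad A (B : state A -> bool -> bool) :
  complete A -> complete (add_bad B).
Proof. by []. Qed.

Lemma period8_add_bad A (B : state A -> bool -> bool) :
  period8 (add_bad B) = period8 A.
Proof. by []. Qed.

Lemma run_add_bad A (B : state A -> bool -> bool) x k :
  run (add_bad B) x k = run A x k.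
Proof. by elim: k => //= k ->. Qed.

Lemma minimal_add_bad A (B : state A -> bool -> bool) x :
  minimal A x -> minimal (add_bad B) x.
Proof. by move=> mx k l; rewrite !run_add_bad; apply: mx. Qed.

Lemma safe_add_bad A (B : state A -> bool -> bool) x :
  safe A x -> (forall k, B (run A x k) (x k) -> False) -> safe (add_bad B) x.
Proof.
move=> sx nB k; rewrite run_add_bad /= negb_or sx /=.
by apply/negP => /nB.
Qed.

Lemma run_const A x k l c : (forall i, i < l -> x (k + i) = c) ->
  run A x (k + l) = iter l ((@step A)^~ c) (run A x k).
Proof.
elim: l => [|l IH] h; first by rewrite addn0.
by rewrite addnS /= IH ?h // => i hi; apply: h; apply: ltnW.
Qed.

(** * Passing runs, safety and minimality to the derivative *)

Section Lift.

Variables (b e m : nat).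
Hypotheses (b4 : 4 <= b) (be : b = m * 8 + e).

Section OneLift.

Variables (A : automaton) (x y : bword).
Hypotheses (cA : complete A) (pA : period8 A) (dxy : decodes b x y).

Let A' := lift e (x 0) A.

Lemma iter_len l c s :
  iter (len b l) ((@step A)^~ c) s = iter (len e l) ((@step A)^~ c) s.
Proof.
case: l => //; rewrite [len b _]be /len; elim: m => [|j IH] //.
by rewrite mulSn -addnA iterD period8_iter.
Qed.

Lemma run_lift k : run A' y k = (x 0 (+) odd k, run A x (bstart b y k)).
Proof.
elim: k => [|k IH]; first by rewrite bstart0 addbF.
rewrite [LHS]/= IH /= bstartS addbN; congr pair.
by rewrite (run_const A (dxy (k := k))) iter_len.
Qed.

Lemma run_lift_letter c k :
  x 0 = c -> run (lift e c A) y k = (c (+) odd k, run A x (bstart b y k)).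
Proof. by move=> <-; apply: run_lift. Qed.

Lemma safe_lift : safe A x -> safe A' y.
Proof.
move=> sx k; rewrite run_lift -all_predC; apply/allP => d /=.
rewrite mem_iota add0n => /andP [_ hd].
(* Lifted badness inspects at most four letters of a block, all present since [4 <= b]. *)
have hd' : d < len b (y k) by case: (y k) hd => //= /leq_trans; apply.
rewrite -(@run_const A x) => [|i hi]; last exact/dxy/(ltn_trans hi).
by rewrite -(dxy hd').
Qed.

(** At the first mismatch of [y], one block has length 1 and the other length b. Both start with the
    same letter, by parity, and only the shorter one is followed at once by the other letter; so [x]
    first differs one place after the start of these blocks. *)
Lemma mismatch_lift k k' l :
  run A' y k = run A' y k' ->
  (forall i, i < l -> y (k + i) = y (k' + i)) -> y (k + l) <> y (k' + l) ->
  exists L, [/\ l <= L, run A x (bstart b y k) = run A x (bstart b y k'),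
    forall i, i < L.+1 -> x (bstart b y k + i) = x (bstart b y k' + i),
    x (bstart b y k + L.+1) <> x (bstart b y k' + L.+1) &
    ~~ x (bstart b y k' + L.+1) = small1 (run A x (bstart b y k' + L.+1)) ->
    ~~ y (k' + l) = small1 (run A' y (k' + l))].
Proof.
rewrite !run_lift => -[/addbI ok rk] agr neq.
have [L [e1 e2 lL agrL]] := agree_blocks b4 dxy ok agr.
have oL : odd (k + l) = odd (k' + l) by rewrite !oddD ok.
have s1 := decodes_start b4 dxy (k + l).
have s2 := decodes_start b4 dxy (k' + l).
have n1 := decodes_next b4 dxy (k + l); have n2 := decodes_next b4 dxy (k' + l).
exists L; split=> //.
- move=> i; rewrite ltnS leq_eqVlt => /orP [/eqP ->|/agrL //].
  by rewrite -e1 -e2 s1 s2 oL.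
- rewrite !addnS -e1 -e2 n1 n2 s1 s2 oL => /addbI /negb_inj; exact: neq.
- rewrite !addnS -e2 [run A x _.+1]/= n2 s2 /=.
  case: (small1 _); case: (y (k' + l)); case: (x 0 (+) odd (k' + l)) => //=.
Qed.

Lemma minimal_lift : minimal A x -> minimal A' y.
Proof.
move=> mx k l k0 l0 rk agr neq.
have [//|//|//|L [_ r1 agrL neqL]] := @mismatch_lift k 0 l.
rewrite bstart0 add0n in r1 agrL neqL *; apply; apply: mx neqL => //.
by apply: leq_trans (leq_bstart b4 y k).
Qed.

(* The first block of [x] is a single letter, so it matches the last letter of
   any block. *)
Lemma minimal_from1_lift : y 0 = false -> minimal A x -> minimal_from1 A' y.
Proof.
move=> y0 mx k l k1 rk agr neq.
have b1 : bstart b y 1 = 1 by rewrite bstartS bstart0 y0.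
have [|||L [_ r1 agrL neqL]] := @mismatch_lift k 1 l; rewrite ?b1 //.
apply; have := leq_bstart b4 y k.
case: k k1 rk r1 agrL neqL {agr neq} => // k k1 rk r1 agrL neqL kB.
have lastk : x (bstart b y k.+1).-1 = x 0.
  have ok : odd k = false.
    by move: rk; rewrite !run_lift => -[/addbI /=]; case: (odd k).
  have l0 := len_gt0 b4 (y k).
  rewrite bstartS -(prednK l0) addnS /= dxy ?ok ?addbF //; lia.
set K := (bstart b y k.+1).-1 in lastk.
have KE : bstart b y k.+1 = K.+1 by rewrite prednK // (leq_trans _ kB).
rewrite KE b1 in r1 agrL neqL kB.
apply: (mx K); rewrite ?add1n //.
- by rewrite -ltnS (leq_trans k1).
(* Reading [x 0] leads from [K] and from 0 to the same state, so the state at [K] is initial. *)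
- by apply: (step_inj (l := x 0) cA pA); rewrite -{1}lastk.
- case=> [|i] hi; first by rewrite addn0.
  by rewrite -[in RHS]add1n -agrL // addnS addSn.
- by rewrite addnS -addSn.
Qed.

(* The first block of [y] is [false^b], and [y] is compared from its second
   letter on, i.e. from inside that block. *)
Lemma minimal_lift_from1 :
  x 0 = false -> y 0 = true -> minimal_from1 A x -> minimal A' y.
Proof.
move=> x0 y0 mx k l k0 l0 rk agr neq.
have [//|//|//|L [lL r1 agrL neqL]] := @mismatch_lift k 0 l.
rewrite bstart0 add0n in r1 agrL neqL *; apply.
have yk : y k = true by rewrite -[k]addn0 agr.
apply: (mx (bstart b y k).+1); rewrite ?addSn -?addnS //.
- by have := leq_bstart b4 y k; lia.
- have := agrL 0 isT; rewrite addn0 /= r1 => ->; by rewrite add0n.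
- by move=> i hi; rewrite addSn -addnS agrL.
Qed.

End OneLift.

Lemma refuted_sound mm d A x : complete A -> refuted e mm d A ->
  derivable_times b d x -> safe A x -> False.
Proof.
have died A' x' : dead mm (init A') -> safe A' x' -> False.
  by move=> h sx; apply: (@dead_not_safe A' x' mm 0).
elim: d A x => [|d IH] A x cA /=; case: ifP => [hd _ _|_] //; try exact: died.
move=> /andP [pA /and3P [rt rf _]] [y dxy dy] sx.
apply: (IH (lift e (x 0) A) y) => //.
- exact: complete_lift.
- by case: (x 0).
- exact: safe_lift.
Qed.

(** * Consequences of minimality *)

Section Consequences.

Variables (A : automaton) (x y : bword).
Hypotheses (cA : complete A) (pA : period8 A) (dxy : decodes b x y).
Hypothesis mx : minimal A x.

(** The letter before block [k] is b, and injectivity of its action makes the state there initial: a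
    suffix comparable with [x] starts at [j]. *)
Lemma block_end k :
  x 0 = true -> run (lift e true A) y k = (false, step (init A) true) ->
  exists2 j, bstart b y k = j.+1 & run A x j = init A /\ x j = true.
Proof.
move=> x0; rewrite (run_lift_letter cA pA dxy) // => -[].
case: k => // k /= ok rk; have l0 := len_gt0 b4 (y k).
rewrite bstartS -(prednK l0) addnS in rk *.
have xj : x (bstart b y k + (len b (y k)).-1) = true.
  by rewrite dxy ?x0 //; lia.
by eexists; first by []; split=> //; move: rk; rewrite /= xj; apply: step_inj.
Qed.

(** Such a state would reveal a suffix b1..., smaller than [x] = bb.... *)
Lemma no_b1 k : x 0 = true -> x 1 = true -> small1 (step (init A) true) ->
  run (lift e true A) y k <> (false, step (init A) true).
Proof.
move=> x0 x1 sm rk; have [j Bj [rj xj]] := block_end x0 rk.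
have xSj : x j.+1 = false.
  rewrite -Bj decodes_start // x0.
  by move: rk; rewrite (run_lift_letter cA pA dxy) // => -[].
have j0 : 0 < j by case: j {Bj rj xj} xSj => //; rewrite x1.
have := mx j0 (ltnSn 0) rj; rewrite /= x0 x1 sm addn1 xSj => h.
by suff: ~~ true = true by []; apply: h => // -[|//] _; rewrite addn0 xj x0.
Qed.

(** Here b is the smaller letter at position 2, so a suffix b1b... would be smaller than [x] =
    b11.... *)
Lemma no_b1b k : x 0 = true -> x 1 = false -> x 2 = false ->
  small1 (step (step (init A) true) false) = false ->
  run (lift e true A) y k = (false, step (init A) true) -> y k <> false.
Proof.
move=> x0 x1 x2 sm rk yk; have [j Bj [rj xj]] := block_end x0 rk.
have xSj : x j.+1 = false.
  rewrite -Bj decodes_start // x0.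
  by move: rk; rewrite (run_lift_letter cA pA dxy) // => -[].
have xSSj : x j.+2 = true.
  by have := decodes_next b4 dxy k; rewrite Bj xSj yk.
have j0 : 0 < j by case: j {Bj rj xj xSj} xSSj => //; rewrite x2.
have := mx j0 (ltn0Sn 1) rj; rewrite /= x0 x1 x2 sm addn2 xSSj => h.
suff: ~~ false = false by []; apply: h => //.
by case=> [|[|//]] _; rewrite ?addn0 ?addn1 ?xj ?xSj ?x0 ?x1.
Qed.

(** Here bb... is smaller than [x] = b1..., so it cannot start in the initial state. A block of b's
    shows bb at its first two positions, whence two excluded states. *)
Lemma no_bb k : x 0 = true -> x 1 = false ->
  small1 (step (init A) true) = false -> y k = true ->
  (run (lift e true A) y k).1 = true ->
  (run (lift e true A) y k).2 <> init A /\
  step (run (lift e true A) y k).2 true <> init A.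
Proof.
move=> x0 x1 sm yk.
have k0 : 0 < k.
  by case: k yk => // y0; have := decodes1 b4 dxy; rewrite y0 x0 x1.
rewrite !(run_lift_letter cA pA dxy) //= => ok.
have B0 := leq_trans k0 (leq_bstart b4 y k).
have xk i : i < 4 -> x (bstart b y k + i) = true.
  by move=> hi; rewrite dxy ?x0 ?ok // yk; apply: leq_trans b4.
have no j : 0 < j -> x j = true -> x j.+1 = true -> run A x j <> init A.
  move=> j0 xj xSj rj; have := mx j0 (ltnSn 0) rj.
  rewrite /= x0 x1 sm addn1 xSj => h.
  by suff: ~~ false = false by []; apply: h => // -[|//] _; rewrite addn0 xj x0.
have xB0 := xk 0 isT; have xB1 := xk 1 isT; have xB2 := xk 2 isT.
rewrite addn0 in xB0; rewrite addn1 in xB1; rewrite addn2 in xB2.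
split; first exact: no.
by have := no (bstart b y k).+1 isT xB1 xB2; rewrite /= xB0.
Qed.

(** Since [x] = 1b... and every suffix is comparable, 11 never occurs. *)
Lemma no_11 k : x 0 = false -> y 0 = false ->
  small1 (step (init A) false) -> (forall j, run A x j = init A) ->
  (run (lift e false A) y k).1 = false -> y k <> true.
Proof.
move=> x0 y0 sm ri ok yk.
have x1 : x 1 = true by rewrite (decodes1 b4 dxy) x0 y0.
have k0 : 0 < k by case: k yk {ok} => //; rewrite y0.
move: ok; rewrite (run_lift_letter cA pA dxy) //= => ok.
have B0 := leq_trans k0 (leq_bstart b4 y k).
have xB := decodes_start b4 dxy k; have xB1 := decodes_next b4 dxy k.
rewrite x0 ok /= in xB; rewrite xB yk /= in xB1.
have := mx B0 (ltnSn 0) (ri _); rewrite /= x0 x1 sm addn1 xB1 => h.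
by suff: ~~ true = true by []; apply: h => // -[|//] _; rewrite addn0 xB x0.
Qed.

End Consequences.

Section ConsequencesFrom1.

Variables (A : automaton) (x y : bword).
Hypotheses (cA : complete A) (pA : period8 A) (dxy : decodes b x y).
Hypotheses (mx : minimal_from1 A x) (x0 : x 0 = false).
Hypothesis cut1 : init A != step (init A) false.

Lemma no_cut1 k : x 1 = true -> small1 (step (init A) false) ->
  run A x k = step (init A) false -> x k <> false.
Proof.
move=> x1 sm rk xk.
have k1 : 1 < k.
  by case: k rk xk => [e1|[|//]]; [move: cut1; rewrite -e1 eqxx | rewrite x1].
have := @mx k 0 k1; rewrite /= x0 x1 sm addn0 xk => h.
by suff: ~~ true = true by []; apply: h.
Qed.

(** Without its first letter [x] starts with b-1 ones and then b. A block of b ones starting in the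
    state reached after the first letter of [x] would be smaller, with mismatch at [b.-1]. *)
Lemma no_1_pow_b k : y 0 = true ->
  small1 (iter e ((@step A)^~ false) (init A)) ->
  run (lift e false A) y k = (false, step (init A) false) -> y k <> true.
Proof.
move=> y0 sm; rewrite (run_lift_letter cA pA dxy) // => -[/= ok rk] yk.
have k0 : 0 < k.
  case: k ok rk yk => // _; rewrite bstart0 /= => e1.
  by move: cut1; rewrite -e1 eqxx.
have B1 : 1 < bstart b y k.
  by have := leq_bstart b4 y k; case: k k0 ok {rk yk} => [|[|k]] //; lia.
have bE : b = b.-1.+1 by lia.
have rb : run A x b = iter e ((@step A)^~ false) (init A).
  have := congr1 snd (run_lift cA pA dxy 1).
  by rewrite bstartS bstart0 /= add0n x0 y0 => ->.
have xb : x b = true.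
  by have := decodes_start b4 dxy 1; rewrite bstartS bstart0 y0 x0.
have := @mx _ b.-1 B1; rewrite -bE rb sm xb => h.
suff: ~~ true = true by []; apply: h; first by rewrite rk /= x0.
- move=> i hi; rewrite dxy ?yk /=; last by lia.
  by have := @dxy 0 i.+1; rewrite bstart0 y0 x0 ok => ->; rewrite //=; lia.
- by rewrite dxy ?yk /=; [rewrite x0 ok | lia].
Qed.

End ConsequencesFrom1.

End Lift.

(** * The case analysis *)

(* [autW], [autV], ..., [autQ] read the words w, v = Delta(w), u = Delta(v), t,
   s, r, q of a Lyndon smooth word whose first letters are 1, b, 1, b, b, b. *)
Definition autW : automaton :=
  Automaton (state := unit) (fun _ _ => tt) tt (fun _ => true)
    (fun _ _ => false) [:: tt].

Section Levels.

Variable e : nat.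

Definition autV := lift e false autW.
Definition autU := lift e true autV.
Definition autT := add_bad (A := lift e false autU)
  (fun s l => (s == (false, step (init autU) false)) && l).
Definition autS := lift e true autT.
Definition autR := add_bad (A := lift e true autS)
  (fun s l => s == (false, step (init autS) true)).
Definition autQ := lift e true autR.

(** Each of these serves one branch of the case split; the added bad pairs come, in order, from
    [no_11], [no_b1], [no_cut1], [no_bb] and [no_b1b]. *)
Definition autV1 := add_bad (A := autV) (fun s l => ~~ s.1 && l).
Definition autUb := add_bad (A := autU)
  (fun s l => s == (false, step (init autV) true)).
Definition autU1 := add_bad (A := autU)
  (fun s l => (s == step (init autU) false) && ~~ l).
Definition autS1 := add_bad (A := autS)
  (fun s l => [&& s.1, l &
     (s.2 == init autT) || (step s.2 true == init autT)]).
Definition autQ1 := add_bad (A := autQ)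
  (fun s l => (s == (false, step (init autR) true)) && ~~ l).

End Levels.

Definition all_refuted e :=
  [&& refuted e 7 5 (autV1 e), refuted e 7 5 (autUb e), refuted e 7 5 (autU1 e),
      refuted e 7 3 (autS1 e),
      refuted e 7 3 (lift e false (lift e true (autS e))),
      refuted e 7 1 (lift e true (autQ e)),
      dead 7 (step (init (lift e false (autQ e))) true) &
      dead 7 (step (init (lift e false (autQ1 e))) false)].

Definition all_period8 e :=
  [&& period8 (autV e), period8 (autU e), period8 (lift e false (autU e)),
      period8 (autS e), period8 (lift e true (autS e)) & period8 (autQ e)].

Definition all_signs e :=
  [&& small1 (step (init (autV e)) true),
      small1 (step (init (autU e)) false),
      init (autU e) != step (init (autU e)) false,
      small1 (iter e ((@step (autU e))^~ false) (init (autU e))),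
      ~~ small1 (step (init (autT e)) true),
      small1 (step (init (autS e)) true) &
      ~~ small1 (step (step (init (autR e)) true) false)].

Lemma finite_checks o (e := 4 * nat_of_bool o) :
  [&& all_refuted e, all_period8 e & all_signs e].
Proof. by rewrite {}/e; case: o; vm_compute. Qed.

(** * From the Lyndon property to the contradiction *)

Lemma Lyndon_minimal b w : 1 < b -> over b w -> infinite_Lyndon w ->
  minimal autW (bcode b w).
Proof.
move=> b1 ow Lw k l k0 _ _ agr neq.
have agr' i : i < l -> w i = w (k + i).
  move=> /agr; rewrite /bcode; case: (ow i) => ->; case: (ow (k + i)) => -> //;
  by rewrite eqxx // ltn_eqF.
have [j agrj ltj] := Lw k k0.
have jl : j = l.
  apply/eqP; rewrite eqn_leq.
  apply/andP; split; rewrite leqNgt; apply/negP => h.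
    by apply: neq; rewrite /bcode (agrj l h).
  by move: ltj; rewrite /suffix_from (agr' j h) ltnn.
move: ltj; rewrite jl /suffix_from /bcode.
case: (ow l) => -> /=; first by rewrite ltn_eqF.
by case: (ow (k + l)) => ->; rewrite ltnNge ?leqnn // ltnW.
Qed.

(** If [w] started with b, the suffix at its second block would start with 1 and be smaller. *)
Lemma Lyndon_first b w v : 1 < b -> over b w -> Delta w v ->
  infinite_Lyndon w -> bcode b w 0 = false.
Proof.
move=> b1 ow [al H] Lw; rewrite /bcode; case: (ow 0) => w0.
  by rewrite w0 ltn_eqF.
have [neq v0 h0] := H 0; have [_ v1 h1] := H 1.
have e0 := h0 0 v0; have e1 := h1 0 v1.
rewrite block_startS /block_start big_ord0 !addn0 add0n in e0 e1.
have wv : w (v 0) = 1.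
  by case: (ow (v 0)) => // wb; case: neq; rewrite -e0 -e1 w0.
have [[|j] agr lt] := Lw _ v0.
  by move: lt; rewrite /suffix_from addn0 wv w0 ltnNge ltnW.
by have := agr 0 isT; rewrite /suffix_from addn0 wv => ->; rewrite ltn_eqF.
Qed.

Theorem theorem32 (n b : nat) (hn : 1 <= n) (hb : b = 4 * n) :
  ~ exists w : infinite_word, smooth b w /\ infinite_Lyndon w.
Proof.
case=> w [sw Lw].
have b4 : 4 <= b by lia.
have b1 : 1 < b by lia.
have [e be /and3P [rf p8 sg]] : exists2 e, b = n./2 * 8 + e &
    [&& all_refuted e, all_period8 e & all_signs e].
  exists (4 * odd n); last exact: finite_checks.
  by rewrite hb -{1}(odd_double_half n) -muln2 mulnDr; lia.
have {rf} /and5P [fV1 fUb fU1 fS1 /and4P [fS fQb fQ fQ1]] := rf.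
have {p8} /and5P [pV pU pT pS /andP [pR pQ]] := p8.
have {sg} /and5P [gV gU cut1 gUe /and3P [/negPf gT gS /negPf gR]] := sg.
have pW : period8 autW by [].
have cW : complete autW by case.
have cV : complete (autV e) := complete_lift cW.
have cU : complete (autU e) := complete_lift cV.
have cT : complete (autT e) := complete_add_bad (complete_lift cU).
have cS : complete (autS e) := complete_lift cT.
have cR0 : complete (lift e true (autS e)) := complete_lift cS.
have cR : complete (autR e) := complete_add_bad cR0.
have cQ : complete (autQ e) := complete_lift cR.
have {}pT : period8 (autT e) by rewrite /autT period8_add_bad.
have pR' : period8 (autR e) by rewrite /autR period8_add_bad.
have mW := Lyndon_minimal b1 (smooth_over sw) Lw.
have [v' dv' _] := smooth_Delta sw.
have w0 := Lyndon_first b1 (smooth_over sw) dv' Lw.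
(* The deepest search goes three derivatives below [q], itself the sixth. *)
have [v dwv [u dvu [t dut [s dts [r dsr [q drq [p dqp dp]]]]]]] :=
  smooth_derivable 9 b1 sw.
move: (bcode b w) dwv mW w0 => x dwv mW w0.
have sW : safe autW x by [].
have mV : minimal (autV e) v.
  by have := minimal_lift b4 be cW pW dwv mW; rewrite w0.
have sV : safe (autV e) v.
  by have := safe_lift b4 be cW pW dwv sW; rewrite w0.
case v0: (v 0); last first.
  apply: (refuted_sound b4 be (complete_add_bad cV) fV1 (x := v)).
    by exists u => //; exists t => //; exists s => //; exists r => //; exists q.
  apply: safe_add_bad => // k /andP [/negPf h].
  by apply: (no_11 b4 be cW pW dwv mW w0 v0 _ _ h) => // j; case: (run _ _ _).
have sU : safe (autU e) u.
  by have := safe_lift b4 be cV pV dvu sV; rewrite v0.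
case u0: (u 0).
  apply: (refuted_sound b4 be (complete_add_bad cU) fUb (x := u)).
    by exists t => //; exists s => //; exists r => //; exists q => //; exists p.
  apply: safe_add_bad => // k /eqP; apply: (no_b1 b4 be cV pV dvu mV v0 _ gV).
  by rewrite (decodes1 b4 dvu) v0 u0.
have mU1 : minimal_from1 (autU e) u.
  by have := minimal_from1_lift b4 be cV pV dvu u0 mV; rewrite v0.
case t0: (t 0); last first.
  apply: (refuted_sound b4 be (complete_add_bad cU) fU1 (x := u)).
    by exists t => //; exists s => //; exists r => //; exists q => //; exists p.
  apply: safe_add_bad => // k /andP [/eqP rk /negPf].
  apply: (no_cut1 mU1 u0 cut1 _ gU rk).
  by rewrite (decodes1 b4 dut) u0 t0.
have mT : minimal (autT e) t.
  apply: minimal_add_bad.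
  by have := minimal_lift_from1 b4 be cU pU dut u0 t0 mU1; rewrite u0.
have sT : safe (autT e) t.
  apply: safe_add_bad.
    by have := safe_lift b4 be cU pU dut sU; rewrite u0.
  move=> k /andP [/eqP rk].
  exact: (no_1_pow_b b4 be cU pU dut mU1 u0 cut1 t0 gUe rk).
have sS : safe (autS e) s.
  by have := safe_lift b4 be cT pT dts sT; rewrite t0.
have mS : minimal (autS e) s.
  by have := minimal_lift b4 be cT pT dts mT; rewrite t0.
case s0: (s 0); last first.
  apply: (refuted_sound b4 be (complete_add_bad cS) fS1 (x := s)).
    by exists r => //; exists q => //; exists p.
  apply: safe_add_bad => // k /and3P [k1 sk].
  have t1 : t 1 = false by rewrite (decodes1 b4 dts) t0 s0.
  have [h1 h2] := no_bb b4 be cT pT dts mT t0 t1 gT sk k1.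
  by case/orP => /eqP.
have sR0 : safe (lift e true (autS e)) r.
  by have := safe_lift b4 be cS pS dsr sS; rewrite s0.
have mR : minimal (autR e) r.
  apply: minimal_add_bad.
  by have := minimal_lift b4 be cS pS dsr mS; rewrite s0.
(* The inherited bad pairs alone refute [r 0] = 1. *)
case r0: (r 0); last first.
  apply: (refuted_sound b4 be (complete_lift cR0) fS (x := q)).
  - by exists p.
  - by have := safe_lift b4 be cR0 pR drq sR0; rewrite r0.
have sR : safe (autR e) r.
  apply: safe_add_bad => // k /eqP; apply: (no_b1 b4 be cS pS dsr mS s0 _ gS).
  by rewrite (decodes1 b4 dsr) s0 r0.
have sQ : safe (autQ e) q.
  by have := safe_lift b4 be cR pR' drq sR; rewrite r0.
case q0: (q 0).
  apply: (refuted_sound b4 be (complete_lift cQ) fQb (x := p)).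
  - by case: dp => o dpo _; exists o.
  - by have := safe_lift b4 be cQ pQ dqp sQ; rewrite q0.
case p0: (p 0).
  apply: (@dead_not_safe (lift e false (autQ e)) p 7 1).
    by have := safe_lift b4 be cQ pQ dqp sQ; rewrite q0.
  by rewrite [run _ _ _]/= p0.
apply: (@dead_not_safe (lift e false (autQ1 e)) p 7 1); last first.
  by rewrite [run _ _ _]/= p0.
have sQ1 : safe (autQ1 e) q.
  apply: safe_add_bad => // k /andP [/eqP rk /negPf].
  have r1 : r 1 = false by rewrite (decodes1 b4 drq) r0 q0.
  have q1 : q 1 = true by rewrite (decodes1 b4 dqp) q0 p0.
  (* The block of [r] starting at position 1 has length b, as [q 1] is b. *)
  have r2 : r 2 = false.
    by have := decodes_next b4 drq 1; rewrite bstartS bstart0 q0 /= q1 r1.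
  exact: (no_b1b b4 be cR pR' drq mR r0 r1 r2 gR rk).
have cQ1 : complete (autQ1 e) := complete_add_bad cQ.
have pQ1 : period8 (autQ1 e) by rewrite /autQ1 period8_add_bad.
by have := safe_lift b4 be cQ1 pQ1 dqp sQ1; rewrite q0.
Qed.
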